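(* Let $\mathcal F$ be the unit $(276,23)$ equiangular tight frame in $\mathbb R^{23}$. Then $\Lambda(\mathcal F)$ is perfect and eutactic, and hence extreme.
   Context: $\langle\cdot,\cdot\rangle$ is the usual inner product on $\mathbb R^k$ and $\|\cdot\|$ the Euclidean norm. A set $\mathcal F=\{\boldsymbol f_1,\dots,\boldsymbol f_n\}\subset\mathbb R^k$ is an $(n,k)$ tight frame if $n>k$, $\operatorname{span}_{\mathbb R}\{\boldsymbol f_1,\dots,\boldsymbol f_n\}=\mathbb R^k$, and there is a real $\gamma>0$ such that $\|\boldsymbol x\|^2=\gamma\sum_{i=1}^n\langle\boldsymbol f_i,\boldsymbol x\rangle^2$ for every $\boldsymbol x\in\mathbb R^k$. A unit $(n,k)$ equiangular tight frame (ETF) of angle $c\in(0,1)$ is an $(n,k)$ tight frame consisting of unit vectors such that $|\langle\boldsymbol f_i,\boldsymbol f_j\rangle|=c$ for all $1\le i\ne j\le n$. ''The'' unit $(276,23)$ ETF is the known unit ETF of $276$ vectors in $\mathbb R^{23}$ (with angle $c=1/5$), which is unique up to orthogonal transformations and replacing some of the vectors by their negatives. Put $\Lambda(\mathcal F)=\operatorname{span}_{\mathbb Z}\{\boldsymbol f_1,\dots,\boldsymbol f_n\}$. For a lattice (discrete additive subgroup) $\Lambda\subset\mathbb R^k$, the minimal norm is $|\Lambda|:=\min\{\|\boldsymbol x\|:\boldsymbol 0\ne\boldsymbol x\in\Lambda\}$, and the set of minimal vectors is $S(\Lambda):=\{\boldsymbol x\in\Lambda:\|\boldsymbol x\|=|\Lambda|\}$.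 A collection $X=\{\boldsymbol x_1,\dots,\boldsymbol x_m\}$, $m\ge k$, of points on the unit sphere in $\mathbb R^k$ is eutactic if there are real numbers $c_1,\dots,c_m>0$ with $\|\boldsymbol y\|^2=\sum_{i=1}^m c_i\langle\boldsymbol y,\boldsymbol x_i\rangle^2$ for every $\boldsymbol y\in\mathbb R^k$. It is perfect if the matrices $\boldsymbol x_1\boldsymbol x_1^\top,\dots,\boldsymbol x_m\boldsymbol x_m^\top$ span the real vector space of all real symmetric $k\times k$ matrices. A lattice is perfect (respectively eutactic) if its set of minimal vectors (scaled to unit length) is perfect (respectively eutactic). A full-rank lattice in $\mathbb R^k$ is extreme if it is a local maximum of the (lattice sphere) packing density function in dimension $k$. *)

(* Defs.v *)
From HB Require Import structures.
From mathcomp Require Import all_boot all_order all_algebra finmap.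
From mathcomp Require Import all_classical all_reals all_analysis.

Set Implicit Arguments.
Unset Strict Implicit.
Unset Printing Implicit Defensive.

Import Order.TTheory GRing.Theory Num.Theory.
Import numFieldNormedType.Exports.

Local Open Scope classical_set_scope.
Local Open Scope ring_scope.

Section EuclideanSpace.
Context {R : realType} {k : nat}.

Definition dot (x y : 'cV[R]_k) : R := \sum_(i < k) x i 0 * y i 0.

(* The library norm `|x| on matrices is the sup norm, hence this definition. *)
Definition enorm (x : 'cV[R]_k) : R := Num.sqrt (dot x x).

End EuclideanSpace.

Section Frames.
Context {R : realType} {n k : nat}.

Definition tight_frame (f : 'I_n -> 'cV[R]_k) : Prop :=
  [/\ (k < n)%N,
      <<codom f>>%VS = fullv &
      exists2 gamma : R, 0 < gamma &
        forall x, enorm x ^+ 2 = gamma * \sum_(i < n) dot (f i) x ^+ 2].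

Definition unit_ETF (c : R) (f : 'I_n -> 'cV[R]_k) : Prop :=
  [/\ 0 < c < 1,
      tight_frame f,
      forall i, enorm (f i) = 1 &
      forall i j, i != j -> `|dot (f i) (f j)| = c].

Definition Zspan (f : 'I_n -> 'cV[R]_k) : set 'cV[R]_k :=
  [set x | exists a : 'I_n -> int, x = \sum_(i < n) f i *~ a i].

End Frames.

Section Lattices.
Context {R : realType} {k : nat}.
Implicit Types (L : set 'cV[R]_k) (X : {fset 'cV[R]_k}) (A B : 'M[R]_k).

(* [isolated L] is the set of isolated points of L; the topology on column
   vectors is the Euclidean one. *)
Definition is_lattice L : Prop := zmod_closed (mem L) /\ L `<=` isolated L.

(* For a nonzero lattice the infimum is attained and positive. *)
Definition min_norm L : R := inf [set enorm x | x in L `\ 0].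

Definition min_vectors L : set 'cV[R]_k :=
  [set x | L x /\ enorm x = min_norm L].

Definition unit_min_vectors L : set 'cV[R]_k :=
  [set (min_norm L)^-1 *: x | x in min_vectors L].

Definition spherical_collection X : Prop :=
  (k <= #|` X|)%N /\ forall x, x \in X -> enorm x = 1.

Definition eutactic X : Prop :=
  spherical_collection X /\
  exists2 c : 'cV[R]_k -> R, (forall x, x \in X -> 0 < c x) &
    forall y, enorm y ^+ 2 = \sum_(x <- X) c x * dot y x ^+ 2.

Definition perfect X : Prop :=
  spherical_collection X /\
  forall Q : 'M[R]_k, Q \in <<[seq x *m x^T | x <- X]>>%VS <-> Q^T = Q.

Definition eutactic_lattice L : Prop :=
  is_lattice L /\ exists2 X, [set` X] = unit_min_vectors L & eutactic X.

Definition perfect_lattice L : Prop :=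
  is_lattice L /\ exists2 X, [set` X] = unit_min_vectors L & perfect X.

(* The lattice whose basis is formed by the columns of A. *)
Definition lattice_of A : set 'cV[R]_k :=
  [set A *m map_mx intr z | z in [set: 'cV[int]_k]].

Definition lattice_basis A L : Prop := A \in unitmx /\ lattice_of A = L.

(* Volume of the unit ball of dimension d: pi^(d/2) / Gamma(d/2 + 1), through
   the recursion w_d = (2 pi / d) w_(d-2), w_0 = 1, w_1 = 2. *)
Fixpoint unit_ball_volume (d : nat) : R :=
  match d with
  | 0%N => 1
  | 1%N => 2
  | (d'.+1 as e).+1 => 2 * pi / e.+1%:R * unit_ball_volume d'
  end.

(* Density of the packing by balls of radius min_norm / 2 centred at the points
   of [lattice_of A]; `|\det A| is the covolume, so the value depends only on
   the lattice. *)
Definition packing_density A : R :=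
  unit_ball_volume k * (min_norm (lattice_of A) / 2) ^+ k / `|\det A|.

(* The space of full-rank lattices is GL_k(R) / GL_k(Z) with the quotient
   topology, so the density has a local maximum at L if and only if it has one,
   as a function on GL_k(R), at some (equivalently, at every) basis of L. *)
Definition extreme L : Prop :=
  exists2 A, lattice_basis A L &
    \forall B \near A, B \in unitmx -> packing_density B <= packing_density A.

End Lattices.

(* Main.v *)
Require Import Defs.
From mathcomp Require Import all_boot all_order all_algebra.
From mathcomp Require Import all_classical all_reals all_analysis.
From mathcomp Require Import finmap ring lra zify.

Set Implicit Arguments.
Unset Strict Implicit.
Unset Printing Implicit Defensive.

Import Order.TTheory GRing.Theory Num.Theory.
Import numFieldNormedType.Exports.

Local Open Scope classical_set_scope.
Local Open Scope ring_scope.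

(** A system of [k(k+1)/2] unit vectors [f_i] of R^k with pairwise squared inner
products [1/(k+2)] attains the absolute bound for equiangular lines, and every
property needed here follows from this numerical fact. Tightness forces the angle
[c^2 = 1/(k+2)] ([unit_ETF_maximal]), because the trace of the frame operator and
its value at a frame vector are both known.

The matrices [f_i f_i^T] have norm [1] and pairwise inner products [c^2 < 1], so
they are linearly independent, and being as many as the dimension of the space
of symmetric matrices they span it ([outer_span]). This is
perfection. Expanding a symmetric matrix [Q] in this basis gives it explicitly
in terms of the values [t_j = f_j^T Q f_j] ([sym_expansion]):
[(k+1) Q = (k+2) sum_j t_j f_j f_j^T - (sum_j t_j) I].
For [Q = x x^T] this yields the second and the fourth moment of the numbers
[<f_j, x>] as multiples of [|x|^2] and [|x|^4] ([moment2], [moment4]); the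
second moment is eutaxy.

The minimal vectors for [k = 23], [c = 1/5] ([Zspan_min_sqnorm]): if
[x = sum_i a_i f_i] is nonzero with integral [a_i], the integers [m_i = 5 <f_i, x>] all
have the parity of [sum_i a_i]. If they are even, [m_i^4 >= 4 m_i^2], and the
two moments give [|x|^2 >= 4/3]. If they are odd, [m_i^2 >= 1] gives
[300 |x|^2 >= 276]; since [5 |x|^2] is an integer, [|x| >= 1]. When [|x| = 1]
the sum of [(m_i^2 - 1)(m_i^2 - 9)] is [900 - 3000 + 2484 > 0], so some [m_i] is
[+5] or [-5], that is, [x] is [f_i] or [- f_i]. Hence the minimal vectors are
exactly the vectors [f_i] and [- f_i].

Extremality is the easy half of the theorem of Voronoi, made explicit
([extreme_Zspan]). A lattice near [Zspan f] is its image under a linear map [T]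
near the identity. Put [Q = T^T T] and let [m] be the least of the values
[|T f_j|^2 = f_j^T Q f_j = m (1 + h_j)], so that [h_j >= 0]. The expansion
above becomes [Q / m = (1 - h/(k+1)) I + (k+2)/(k+1) sum_j h_j f_j f_j^T] with
[h = sum_j h_j], and adding the rank-one terms one at a time bounds its
determinant from below ([det_rank1_sum_ge]) by [1 + h ((k+2) - k)/(k+1)] to
first order, so by [1] when [h] is small ([det_ge_of_values]). Thus
[det T^2 = det Q >= m^k], while the minimal norm of the image is at most the
square root of [m]: the density does not increase. A basis of [Zspan f],
required to speak of its density, comes from the Smith normal form
([Zspan_has_basis]). *)

(** * The Euclidean inner product *)

Section DotProduct.
Context {R : realType} {k : nat}.
Implicit Types (x y z : 'cV[R]_k) (Q : 'M[R]_k).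

Lemma dotE x y : x^T *m y = (dot x y)%:M.
Proof.
apply/matrixP=> i j; rewrite !ord1 !mxE eqxx mulr1n.
by apply: eq_bigr => l _; rewrite !mxE.
Qed.

Lemma dotC x y : dot x y = dot y x.
Proof. by apply: eq_bigr => i _; rewrite mulrC. Qed.

Lemma dot_suml n (g : 'I_n -> 'cV[R]_k) y :
  dot (\sum_i g i) y = \sum_i dot (g i) y.
Proof.
rewrite /dot exchange_big /=; apply: eq_bigr => l _.
by rewrite summxE mulr_suml.
Qed.

Lemma dotZl a x y : dot (a *: x) y = a * dot x y.
Proof. by rewrite /dot mulr_sumr; apply: eq_bigr => i _; rewrite mxE mulrA. Qed.

Lemma dotZr a x y : dot x (a *: y) = a * dot x y.
Proof. by rewrite dotC dotZl dotC. Qed.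

Lemma dotDl x y z : dot (x + y) z = dot x z + dot y z.
Proof.
by rewrite /dot -big_split; apply: eq_bigr => i _; rewrite mxE mulrDl.
Qed.

Lemma dotDr x y z : dot x (y + z) = dot x y + dot x z.
Proof. by rewrite dotC dotDl !(dotC x). Qed.

Lemma dotNl x y : dot (- x) y = - dot x y.
Proof. by rewrite -scaleN1r dotZl mulN1r. Qed.

Lemma dotNr x y : dot x (- y) = - dot x y.
Proof. by rewrite dotC dotNl dotC. Qed.

Lemma dot_ge0 x : 0 <= dot x x.
Proof. by apply: sumr_ge0 => i _; rewrite -expr2 sqr_ge0. Qed.

Lemma dot_eq0 x : (dot x x == 0) = (x == 0).
Proof.
rewrite /dot psumr_eq0; last by move=> i _; rewrite -expr2 sqr_ge0.
apply/allP/eqP => [x0|-> i _]; last by rewrite mxE mul0r eqxx.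
apply/matrixP=> i j; rewrite ord1 mxE.
by have := x0 i (mem_index_enum _); rewrite mulf_eq0 orbb => /eqP.
Qed.

Lemma enorm_sq x : enorm x ^+ 2 = dot x x.
Proof. by rewrite /enorm sqr_sqrtr // dot_ge0. Qed.

Lemma tr_outer x y : \tr (x *m y^T) = dot x y.
Proof. by rewrite mxtrace_mulC dotE mxtrace_scalar mulr1n dotC. Qed.

Lemma tr_mul_outer Q x : \tr (Q *m (x *m x^T)) = dot x (Q *m x).
Proof. by rewrite mulmxA tr_outer dotC. Qed.

Lemma outer_mul x y : x *m x^T *m y = dot x y *: x.
Proof. by rewrite -mulmxA dotE mul_mx_scalar. Qed.

Lemma dot_mulmx (B : 'M[R]_k) x : dot (B *m x) (B *m x) = dot x (B^T *m B *m x).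
Proof.
have E y z : dot y z = (y^T *m z) 0 0 by rewrite dotE mxE mulr1n.
by rewrite !E trmx_mul !mulmxA.
Qed.

Lemma cauchy_unit x y : dot x x = 1 -> dot y y = 1 -> dot x y ^+ 2 <= 1.
Proof.
move=> x1 y1.
have := dot_ge0 (x - dot x y *: y).
rewrite dotDl !dotDr !(dotNl, dotNr) !(dotZl, dotZr) x1 y1 (dotC y x).
nra.
Qed.

Lemma dot_eq1 x y : dot x x = 1 -> dot y y = 1 -> dot x y = 1 -> x = y.
Proof.
move=> x1 y1 xy; apply/eqP; rewrite -subr_eq0 -dot_eq0.
rewrite dotDl !dotDr !(dotNl, dotNr) x1 y1 (dotC y x) xy.
by apply/eqP; ring.
Qed.

End DotProduct.

(** * Maximal equiangular systems *)

(** Both sides have the same dimension: a symmetric matrix is determined by its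
entries on or above the diagonal, and there are ['C(k.+1, 2)] of these. *)
Lemma free_sym_span (F : fieldType) (n k : nat) (S : 'I_n -> 'M[F]_k)
    (Ssym : forall i, (S i)^T = S i)
    (Sfree : forall a : 'I_n -> F, \sum_i a i *: S i = 0 -> forall i, a i = 0)
    (nE : n = 'C(k.+1, 2)) (Q : 'M[F]_k) (Qsym : Q^T = Q) :
  exists a : 'I_n -> F, Q = \sum_i a i *: S i.
Proof.
pose U := [set p : 'I_k * 'I_k | (p.1 <= p.2)%N]%SET.
have cardU : #|U| = n.
  rewrite nE -bin2_sum -sum1dep_card.
  rewrite -(pair_big_dep xpredT (fun i j : 'I_k => (i <= j)%N)
    (fun _ _ => 1%N)) (exchange_big_dep xpredT) //=.
  rewrite big_mkord big_ord_recl add0n; apply: eq_bigr => j _.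
  rewrite lift0 -(big_mkord (fun i => (i <= j)%N) (fun=> 1%N)).
  rewrite (big_cat_nat (n := j.+1)) //=.
  rewrite [X in (_ + X)%N]big1_seq ?addn0; last first.
    by move=> i; rewrite mem_index_iota ltnNge => /andP[-> ].
  rewrite -[RHS](card_ord j.+1) -sum1_card big_mkord.
  by apply: eq_bigl => i; rewrite -ltnS ltn_ord.
pose M := \matrix_(i < n, p < #|U|) S i (enum_val p).1 (enum_val p).2.
have ME (a : 'rV_n) p : (a *m M) 0 p =
    (\sum_i a 0 i *: S i) (enum_val p).1 (enum_val p).2.
  by rewrite mxE summxE; apply: eq_bigr => i _; rewrite !mxE.
have symP (A B : 'M[F]_k) : A^T = A -> B^T = B ->
    (forall p : 'I_#|U|, A (enum_val p).1 (enum_val p).2 =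
      B (enum_val p).1 (enum_val p).2) -> A = B.
  move=> AT BT AB; have le (i j : 'I_k) : (i <= j)%N -> A i j = B i j.
    move=> ij; have Uij : (i, j) \in U by rewrite inE.
    by have := AB (enum_rank_in Uij (i, j)); rewrite enum_rankK_in.
  apply/matrixP=> i j; case: (leqP i j) => [/le//|/ltnW/le].
  by rewrite -[in A j i]AT -[in B j i]BT !mxE.
have combT (a : 'I_n -> F) : (\sum_i a i *: S i)^T = \sum_i a i *: S i.
  by rewrite linear_sum; apply: eq_bigr => i _; rewrite linearZ /= Ssym.
have Mfree : row_free M.
  rewrite -kermx_eq0 -submx0; apply/row_subP=> l; rewrite submx0.
  set a := row l _; have aM : a *m M = 0.
    by apply/sub_kermxP; rewrite row_sub.
  apply/eqP/rowP=> i; rewrite [RHS]mxE; apply: (Sfree (a 0)).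
  by apply: symP; rewrite ?trmx0 // => p; rewrite -ME aM !mxE.
pose q := \row_p Q (enum_val (A := U) p).1 (enum_val p).2.
have [a aM] : exists a, q = a *m M
  by apply/submxP; rewrite submx_full // /row_full (eqP Mfree) cardU.
by exists (a 0); apply: symP => // p; rewrite -ME -aM mxE.
Qed.

Lemma natr_bin2 (R : realType) (n k : nat) : n = 'C(k.+1, 2) ->
  n%:R = k.+1%:R * k%:R / 2 :> R.
Proof.
move=> nE; have : (k.+1 * k = 2 * n)%N by rewrite nE -mul_bin_diag bin1.
by move/(congr1 (fun m => m%:R : R)); rewrite !natrM => ->; field.
Qed.

Section MaximalFrames.
Context {R : realType} {n k : nat}.
Implicit Types (f : 'I_n -> 'cV[R]_k) (x : 'cV[R]_k) (Q : 'M[R]_k).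

(** Equality in the absolute bound [n <= k(k+1)/2] on the number of equiangular
lines; the squared cosine is then necessarily [1/(k+2)]. *)
Definition maximal_equiangular f : Prop :=
  [/\ n = 'C(k.+1, 2), forall i, dot (f i) (f i) = 1 &
      forall i j, i != j -> dot (f i) (f j) ^+ 2 = k.+2%:R^-1].

(** The entrywise square of the Gram matrix is [(1 - c^2) I + c^2 J], with [J]
the all-ones matrix and [c^2 = 1/(k+2)]. *)
Lemma dot_sq_combination f (a : 'I_n -> R) j : maximal_equiangular f ->
  k.+2%:R * \sum_i a i * dot (f i) (f j) ^+ 2 = k.+1%:R * a j + \sum_i a i.
Proof.
case=> _ f1 fc; rewrite (bigD1 j) //= [in RHS](bigD1 j) //= f1 expr1n mulr1.
rewrite (eq_bigr (fun i => a i * k.+2%:R^-1)); last first.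
  by move=> i /fc ->.
rewrite -mulr_suml mulrDr [X in _ + X]mulrCA mulfV ?pnatr_eq0 // mulr1.
by rewrite addrA -[k.+2]addn1 natrD mulrDl mul1r.
Qed.

Lemma tr_combination_mul_outer f (a : 'I_n -> R) x :
  \tr ((\sum_i a i *: (f i *m (f i)^T)) *m (x *m x^T)) =
  \sum_i a i * dot (f i) x ^+ 2.
Proof.
rewrite tr_mul_outer mulmx_suml dotC dot_suml; apply: eq_bigr => i _.
by rewrite -scalemxAl outer_mul !dotZl expr2.
Qed.

Lemma tr_combination f (a : 'I_n -> R) : (forall i, dot (f i) (f i) = 1) ->
  \tr (\sum_i a i *: (f i *m (f i)^T)) = \sum_i a i.
Proof.
move=> f1; rewrite linear_sum; apply: eq_bigr => i _.
by rewrite linearZ /= tr_outer f1 mulr1.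
Qed.

Lemma outer_sym x : (x *m x^T)^T = x *m x^T.
Proof. by rewrite trmx_mul trmxK. Qed.

(** A vanishing combination of the [f_i f_i^T] has coefficients summing to [0],
by the trace; pairing it with [f_j f_j^T] then isolates the coefficient [a j]. *)
Lemma outer_span f Q : maximal_equiangular f -> Q^T = Q ->
  exists a : 'I_n -> R, Q = \sum_i a i *: (f i *m (f i)^T).
Proof.
move=> fM; have [nE f1 _] := fM.
apply: (free_sym_span _ _ nE) => [i|a a0 j]; first exact: outer_sym.
have := dot_sq_combination a j fM.
rewrite -tr_combination_mul_outer -(tr_combination a f1) a0 mul0mx mxtrace0.
by move/eqP; rewrite mulr0 addr0 eq_sym mulf_eq0 pnatr_eq0 => /eqP.
Qed.

(** The coefficients of the identity are determined by pairing it with the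
[f_j f_j^T], and come out equal: the system is a tight frame. *)
Lemma outer_sum f : maximal_equiangular f ->
  \sum_i f i *m (f i)^T = (k.+1%:R / 2)%:M.
Proof.
move=> fM; have [_ f1 _] := fM.
have [a a1] := outer_span fM (@trmx1 R k).
have aE j : k.+1%:R * a j = 2.
  have := dot_sq_combination a j fM.
  rewrite -tr_combination_mul_outer -(tr_combination a f1) -a1 mul1mx.
  rewrite tr_outer f1 mxtrace1 mulr1 -[k.+2]addn2 natrD addrC.
  by move/addIr.
rewrite -scalemx1 [in RHS]a1 scaler_sumr; apply: eq_bigr => i _.
by rewrite scalerA mulrAC aE divff ?scale1r // pnatr_eq0.
Qed.

Lemma sum_tr_outer f Q : maximal_equiangular f ->
  \sum_j \tr (Q *m (f j *m (f j)^T)) = k.+1%:R / 2 * \tr Q.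
Proof.
move=> fM; rewrite -linear_sum -mulmx_sumr outer_sum //=.
by rewrite mul_mx_scalar linearZ.
Qed.

(** Inverting [(1 - c^2) I + c^2 J] expresses the coefficients of [Q] through
the values [t j] of its quadratic form at the frame. *)
Lemma sym_expansion f Q : maximal_equiangular f -> Q^T = Q ->
  let t j := \tr (Q *m (f j *m (f j)^T)) in
  k.+1%:R *: Q =
  k.+2%:R *: \sum_j t j *: (f j *m (f j)^T) - (\sum_j t j)%:M.
Proof.
move=> fM QT t; have [_ f1 _] := fM; rewrite sum_tr_outer //.
have [a Qa] := outer_span fM QT.
have tE j : k.+2%:R * t j = k.+1%:R * a j + \tr Q.
  rewrite [in \tr Q]Qa tr_combination // -(dot_sq_combination a j fM).
  by rewrite -tr_combination_mul_outer -Qa.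
rewrite scaler_sumr (eq_bigr (fun j => (k.+1%:R * a j) *: (f j *m (f j)^T) +
  \tr Q *: (f j *m (f j)^T))); last by move=> j _; rewrite scalerA tE scalerDl.
rewrite big_split /= -scaler_sumr outer_sum // scale_scalar_mx mulrC addrK.
by rewrite {1}Qa scaler_sumr; apply: eq_bigr => j _; rewrite scalerA.
Qed.

Lemma moment2 f x : maximal_equiangular f ->
  \sum_i dot (f i) x ^+ 2 = k.+1%:R / 2 * dot x x.
Proof.
move=> fM; rewrite -tr_outer -(sum_tr_outer _ fM).
by apply: eq_bigr => i _; rewrite tr_mul_outer outer_mul dotZr expr2 (dotC x).
Qed.

(** With [moment2], this says that the vectors [f_i] and [- f_i] form a
spherical design of strength 5. *)
Lemma moment4 f x : maximal_equiangular f ->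
  k.+2%:R * \sum_i dot (f i) x ^+ 4 = k.+1%:R * 3 / 2 * dot x x ^+ 2.
Proof.
move=> fM.
have tE j : \tr (x *m x^T *m (f j *m (f j)^T)) = dot (f j) x ^+ 2.
  by rewrite tr_mul_outer outer_mul dotZr expr2 (dotC x).
have := congr1 (fun M => \tr (M *m (x *m x^T)))
  (sym_expansion fM (outer_sym x)).
rewrite /= mulmxBl -!scalemxAl linearB /= !linearZ /= tr_combination_mul_outer.
rewrite mul_scalar_mx linearZ /= tr_mul_outer outer_mul dotZr tr_outer.
under eq_bigr do rewrite tE.
under [in X in _ - X]eq_bigr do rewrite tE.
rewrite moment2 //; under eq_bigr do rewrite -exprD.
move=> E; have -> : k.+2%:R * (\sum_i dot (f i) x ^+ 4) =
  k.+1%:R * (dot x x * dot x x) + k.+1%:R / 2 * dot x x * dot x x.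
  by rewrite E subrK.
by field.
Qed.

(** The identity [|x|^2 = g sum_i <f_i, x>^2], summed over an orthonormal basis,
gives [k = g n]; at [x = f_i] it gives [1 = g (1 + (n - 1) c^2)]. This is the
equality case of the Welch bound, and it determines [c]. *)
Lemma unit_ETF_maximal f (c : R) : n = 'C(k.+1, 2) -> unit_ETF c f ->
  maximal_equiangular f.
Proof.
move=> nE [_ [lt_kn _ [g g0 gE]] fn fc].
have f1 i : dot (f i) (f i) = 1 by rewrite -enorm_sq fn expr1n.
split=> // i j ij.
have nR := natr_bin2 R nE.
have kg : k%:R = g * n%:R.
  transitivity (\sum_(l < k) enorm (delta_mx l 0 : 'cV[R]_k) ^+ 2).
    rewrite -[in LHS](card_ord k) -sumr_const; apply: eq_bigr => l _.
    rewrite enorm_sq /dot (bigD1 l) //= !mxE !eqxx mulr1 big1 ?addr0 //.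
    by move=> m /negbTE ml; rewrite !mxE ml mulr0.
  under eq_bigr do rewrite gE.
  rewrite -mulr_sumr exchange_big /= -[in RHS](card_ord n) -sumr_const.
  congr (_ * _); apply: eq_bigr => l _; rewrite -(f1 l).
  apply: eq_bigr => m _; rewrite /dot (bigD1 m) //= mxE !eqxx mulr1.
  rewrite big1 ?addr0 ?expr2 // => m' /negbTE mm'.
  by rewrite !mxE mm' mulr0.
have welch : 1 = g * (1 + (n%:R - 1) * c ^+ 2).
  have := gE (f i); rewrite enorm_sq f1 (bigD1 i) //= f1 expr1n => e1.
  rewrite [LHS]e1.
  congr (_ * (_ + _)); rewrite (eq_bigr (fun=> c ^+ 2)); last first.
    by move=> l li; rewrite -(fc _ _ li) real_normK ?num_real.
  rewrite sumr_const cardC1 card_ord.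
  have n_gt0 : (0 < n)%N := leq_ltn_trans (leq0n i) (ltn_ord i).
  by rewrite -[n in RHS](prednK n_gt0) -natr1 addrK mulr_natl.
have -> : dot (f i) (f j) ^+ 2 = c ^+ 2.
  by rewrite -(fc _ _ ij) real_normK ?num_real.
have k1 : 1 < k%:R :> R.
  rewrite ltr1n; move: lt_kn; rewrite nE; case: (k) => [|[|k']] //.
have k2E : k.+2%:R = k%:R + 2 :> R by rewrite -natrD addn2.
have k1E : k.+1%:R = k%:R + 1 :> R by rewrite -natr1.
have n0 : n%:R != 0 :> R by rewrite nR k1E; apply/eqP; nra.
have gE' : g = k%:R / n%:R by rewrite kg mulfK.
have kc : k%:R * (1 + (n%:R - 1) * c ^+ 2) = n%:R.
  by rewrite -[RHS]mulr1 [X in _ = _ * X]welch gE'; field.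
rewrite k2E; apply: (mulfI (x := k%:R * (k%:R - 1) * (k%:R + 2))).
  by rewrite !mulf_neq0 //; apply/eqP; lra.
rewrite nR k1E in kc.
rewrite mulfK; last by apply/eqP; lra.
lra.
Qed.

End MaximalFrames.

(** * A lower bound for determinants of rank-one updates *)

Section Determinant.

(** Sylvester's identity for rank one: the two sides are the Schur complements
of the two diagonal blocks of one block matrix. *)
Lemma det_one_add_outer (F : comNzRingType) k (v u : 'cV[F]_k) :
  \det (1%:M + v *m u^T) = 1 + (u^T *m v) 0 0.
Proof.
have E : block_mx (1%:M + v *m u^T) (- v) 0 1%:M *m block_mx 1%:M 0 u^T 1%:M =
    block_mx 1%:M 0 u^T 1%:M *m
    block_mx 1%:M (- v) 0 (1%:M + u^T *m v) :> 'M[F]_(k + 1).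
  rewrite !mulmx_block !mulmx1 !mul1mx !mulmx0 !mul0mx !addr0 !add0r.
  by rewrite mulNmx addrK mulmxN addrCA addNr addr0.
have := congr1 determinant E.
rewrite !det_mulmx !det_ublock !det_lblock !det1 !mul1r !mulr1 => ->.
by rewrite det_mx11 !mxE eqxx.
Qed.

Context {R : realType} {n k : nat}.
Implicit Types (f : 'I_n -> 'cV[R]_k).

(** For the positive definite matrix [M] this is [M^2 <= C M] with [C] the trace
bound [a + sum w] on the largest eigenvalue, in a form that avoids eigenvalues.
Adding a rank-one term preserves it. *)
Lemma mulmx_sq_le f (a : R) (w : 'I_n -> R) (r : seq 'I_n) (y : 'cV[R]_k) :
    0 < a -> (forall i, 0 <= w i) -> (forall i, dot (f i) (f i) = 1) ->
  let M := a%:M + \sum_(i <- r) w i *: (f i *m (f i)^T) in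
  dot (M *m y) (M *m y) <= (a + \sum_(i <- r) w i) * dot y (M *m y).
Proof.
move=> a0 w0 f1 /=; elim: r => [|i r IH].
  by rewrite !big_nil !addr0 mul_scalar_mx !(dotZl, dotZr).
rewrite !big_cons.
move: IH; set D0 := \sum_(j <- r) w j; set S0 := \sum_(j <- r) _.
have D0_ge0 : 0 <= D0 by apply: sumr_ge0.
have -> : (a%:M + (w i *: (f i *m (f i)^T) + S0)) *m y =
    (a%:M + S0) *m y + (w i * dot (f i) y) *: f i.
  by rewrite addrCA addrC mulmxDl -scalemxAl outer_mul scalerA.
set g := (_ + S0) *m y => IH.
set s := dot (f i) y.
have cauchy : 2 * s * dot g (f i) <= dot y g + (a + D0) * s ^+ 2.
  (* this square is nonnegative, and [dot g g] in it is at most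
     [(a + D0) * dot y g]; divide by [a + D0] *)
  have := dot_ge0 (g - ((a + D0) * s) *: f i).
  rewrite dotDl !dotDr !(dotNl, dotNr) !(dotZl, dotZr) f1 (dotC (f i) g) => h.
  have D1 : 0 < a + D0 by lra.
  rewrite -(ler_pM2l D1); nra.
rewrite dotDl !dotDr !(dotZl, dotZr) f1 (dotC (f i) g) (dotC y (f i)) -/s.
have := w0 i; nra.
Qed.

(** Each rank-one update multiplies the determinant by [1 + w u^T M^-1 u], and
[u^T M^-1 u] is at least the inverse of the largest eigenvalue of [M], by
[mulmx_sq_le] applied to [M^-1 u]. *)
Lemma det_rank1_sum_ge f (a C : R) (w : 'I_n -> R) (r : seq 'I_n) :
    0 < a -> (forall i, 0 <= w i) -> (forall i, dot (f i) (f i) = 1) ->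
    a + \sum_(i <- r) w i <= C ->
  a ^+ k * (1 + (\sum_(i <- r) w i) / C) <=
  \det (a%:M + \sum_(i <- r) w i *: (f i *m (f i)^T)).
Proof.
move=> a0 w0 f1; elim: r => [|i r IH].
  by rewrite !big_nil mul0r !addr0 mulr1 det_scalar.
rewrite !big_cons => hC; have wi := w0 i.
have {IH} := IH ltac:(lra); have /= := mulmx_sq_le r _ a0 w0 f1.
move: hC; set W := \sum_(j <- r) w j; set M := a%:M + \sum_(j <- r) _.
move=> hC Msq detM; have W0 : 0 <= W by apply: sumr_ge0.
have C0 : 0 < C by lra.
have ak : 0 < a ^+ k by rewrite exprn_gt0.
have WC : 0 <= W / C by rewrite divr_ge0 // ltW.
have detM0 : 0 < \det M by apply: lt_le_trans detM; rewrite mulr_gt0 //; lra.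
have Mu : M \in unitmx by rewrite unitmxE unitfE gt_eqF.
set y := invmx M *m f i.
have My : M *m y = f i by rewrite mulmxA mulmxV // mul1mx.
have yf : C^-1 <= dot (f i) y.
  have h := Msq y; rewrite My f1 (dotC y) in h.
  rewrite -(ler_pM2l C0) mulfV ?gt_eqF //; apply: (le_trans h).
  have : 0 <= dot (f i) y.
    rewrite -(pmulr_rge0 _ (_ : 0 < a + W)); last by lra.
    exact: le_trans ler01 h.
  by move=> fy; apply: ler_wpM2r => //; lra.
have -> : a%:M + (w i *: (f i *m (f i)^T) +
      \sum_(j <- r) w j *: (f j *m (f j)^T)) =
    M *m (1%:M + (w i *: y) *m (f i)^T).
  by rewrite addrCA addrC mulmxDr mulmx1 mulmxA -scalemxAr My -scalemxAl.
rewrite det_mulmx det_one_add_outer -scalemxAr mxE dotE mxE mulr1n.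
have wC : w i / C <= w i * dot (f i) y by apply: ler_wpM2l.
have wC0 : 0 <= w i / C by rewrite divr_ge0 // ltW.
apply: le_trans (_ : a ^+ k * (1 + W / C) * (1 + w i / C) <= _).
  by rewrite -mulrA ler_pM2l // mulrDl; nra.
apply: ler_pM => //; last by lra.
- by rewrite mulr_ge0 ?ltW //; lra.
- by lra.
Qed.

End Determinant.

Lemma bernoulli_ineq (R : realType) (u : R) (k : nat) : u <= 1 ->
  1 - k%:R * u <= (1 - u) ^+ k.
Proof.
move=> u1; elim: k => [|k IH]; first by rewrite mul0r subr0 expr0.
have : (1 - u) * (1 - k%:R * u) <= (1 - u) ^+ k.+1.
  by rewrite exprS ler_wpM2l // subr_ge0.
by apply: le_trans; rewrite -natr1; have : 0 <= k%:R * u ^+ 2 :> R;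
  [rewrite mulr_ge0 ?sqr_ge0 ?ler0n | nra].
Qed.

Section LocalMaximum.
Context {R : realType} {n k : nat}.
Implicit Types (f : 'I_n -> 'cV[R]_k) (Q : 'M[R]_k).

(** In the expansion of [Q / m] the coefficients [w j] are nonnegative multiples
of the excesses [h j = t j / m - 1], with [a + sum w = 1 + eta] for
[eta = sum h]. The bound [a^k (1 + sum w / (1 + eta))] of [det_rank1_sum_ge] is
[1 + 2 eta / (k+1)] up to second order in [eta], and is at least [1] as long as
[eta <= 1/(k+2)]. *)
Lemma det_ge_of_values f Q (m : R) :
    maximal_equiangular f -> Q^T = Q -> 0 < m ->
  let t j := \tr (Q *m (f j *m (f j)^T)) in
    (forall j, m <= t j) -> \sum_j t j <= m * (n%:R + k.+2%:R^-1) ->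
  m ^+ k <= \det Q.
Proof.
move=> fM QT m0 t mt tle; have [nE f1 _] := fM.
have nR := natr_bin2 R nE.
pose h j := t j / m - 1; pose eta := \sum_j h j.
have h0 j : 0 <= h j by rewrite subr_ge0 ler_pdivlMr // mul1r.
have sumt : \sum_j t j = m * (n%:R + eta).
  rewrite /eta sumrB -mulr_suml sumr_const card_ord -[1 *+ n]/(n%:R).
  by rewrite addrC subrK mulrC divfK // gt_eqF.
have eta0 : 0 <= eta by apply: sumr_ge0.
have k2 : 0 < k.+2%:R :> R by rewrite ltr0n.
have kp : 0 < k.+1%:R :> R by rewrite ltr0n.
have eta_le : k.+2%:R * eta <= 1.
  by move: tle; rewrite sumt ler_pM2l // lerD2l -(ler_pM2l k2) mulfV ?gt_eqF.
pose a := 1 - eta / k.+1%:R.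
pose w j := k.+2%:R / k.+1%:R * h j.
have w0 j : 0 <= w j by rewrite mulr_ge0 ?divr_ge0 ?ler0n.
have QE : Q = m *: (a%:M + \sum_j w j *: (f j *m (f j)^T)).
  apply: (scalerI (a := k.+1%:R)); first by rewrite pnatr_eq0.
  rewrite (sym_expansion fM QT) /= -/t sumt.
  have -> : \sum_j t j *: (f j *m (f j)^T) =
      m *: \sum_j f j *m (f j)^T + m *: \sum_j h j *: (f j *m (f j)^T).
    rewrite !scaler_sumr -big_split /=; apply: eq_bigr => j _.
    rewrite scalerA -scalerDl; congr (_ *: _).
    by rewrite /h mulrBr mulr1 mulrC divfK ?gt_eqF // addrC subrK.
  have -> : \sum_j w j *: (f j *m (f j)^T) =
      (k.+2%:R / k.+1%:R) *: \sum_j h j *: (f j *m (f j)^T).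
    by rewrite scaler_sumr; apply: eq_bigr => j _; rewrite scalerA.
  set H := \sum_j h j *: _.
  rewrite (outer_sum fM) nR !scalerDr !scalerA !scale_scalar_mx addrAC.
  rewrite -raddfB /=; congr (_%:M + _ *: _); rewrite /a.
    by rewrite -[k.+2%:R]natr1; field; rewrite gt_eqF.
  by field; rewrite gt_eqF.
rewrite QE detZ -[leLHS]mulr1 ler_pM2l ?exprn_gt0 //.
have eta1 : 0 < 1 + eta by lra.
have k2E : k.+2%:R = k.+1%:R + 1 :> R by rewrite -natr1.
have k1E : k%:R = k.+1%:R - 1 :> R by rewrite -natr1 addrK.
have kp1 : 1 <= k.+1%:R :> R by rewrite ler1n.
have u1 : eta / k.+1%:R < 1.
  by rewrite ltr_pdivrMr // mul1r; rewrite k2E in eta_le; nra.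
have a0 : 0 < a by rewrite subr_gt0.
have Wsum : \sum_j w j = k.+2%:R / k.+1%:R * eta by rewrite -mulr_sumr.
apply: le_trans (det_rank1_sum_ge (C := 1 + eta) a0 w0 f1 _); last first.
  rewrite Wsum /a k2E le_eqVlt; apply/orP; left; apply/eqP; field.
  by rewrite gt_eqF.
rewrite Wsum; have W1 : 0 <= k.+2%:R / k.+1%:R * eta / (1 + eta).
  by rewrite !mulr_ge0 ?invr_ge0 ?ler0n // ltW.
apply: le_trans (_ : (1 - k%:R * (eta / k.+1%:R)) *
  (1 + k.+2%:R / k.+1%:R * eta / (1 + eta)) <= _); last first.
  by apply: ler_wpM2r; [exact: addr_ge0 ler01 W1 | exact/bernoulli_ineq/ltW].
rewrite -subr_ge0 k2E k1E; set K := k.+1%:R in kp kp1 *.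
have -> : (1 - (K - 1) * (eta / K)) * (1 + (K + 1) / K * eta / (1 + eta)) - 1 =
  eta / (K ^+ 2 * (1 + eta)) * (2 * K - (K - 1) * (2 * K + 1) * eta).
  by field; rewrite !gt_eqF.
rewrite k2E -/K in eta_le.
apply: mulr_ge0; first by rewrite divr_ge0 ?mulr_ge0 ?sqr_ge0 //; lra.
nra.
Qed.

End LocalMaximum.

(** * Bases of lattices generated by a frame *)

Section LatticeBasis.
Context {R : realType} {n k : nat}.
Implicit Types (f : 'I_n -> 'cV[R]_k).

Definition frame_mx f : 'M[R]_(k, n) := \matrix_(i, j) f j i 0.

Lemma frame_mx_mul f (b : 'cV[R]_n) : frame_mx f *m b = \sum_j b j 0 *: f j.
Proof.
apply/matrixP=> i j; rewrite !ord1 mxE summxE.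
by apply: eq_bigr => l _; rewrite !mxE mulrC.
Qed.

Lemma frame_mx_mul_tr f : frame_mx f *m (frame_mx f)^T = \sum_j f j *m (f j)^T.
Proof.
apply/matrixP=> i j; rewrite mxE summxE.
by apply: eq_bigr => l _; rewrite !mxE big_ord1 !mxE.
Qed.

Lemma ZspanE f : Zspan f =
  [set frame_mx f *m map_mx intr z | z in [set: 'cV[int]_n]].
Proof.
apply/seteqP; split=> x /=.
  move=> [a ->]; exists (\col_i a i) => //; rewrite frame_mx_mul.
  by apply: eq_bigr => i _; rewrite !mxE scaler_int.
move=> [z _ <-]; exists (fun i => z i 0); rewrite frame_mx_mul.
by apply: eq_bigr => i _; rewrite !mxE scaler_int.
Qed.

(** The Smith normal form of an integral matrix of coordinates of the generators
exhibits a basis of the lattice that they generate. Such coordinates are [N]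
times the inner products with [k] linearly independent generators. *)
Lemma Zspan_has_basis f (N c : R) :
    N != 0 -> (forall i j, N * dot (f i) (f j) \is a Num.int) ->
    c != 0 -> \sum_i f i *m (f i)^T = c%:M ->
  exists A, lattice_basis A (Zspan f).
Proof.
move=> N0 Nint c0 fc; set F := frame_mx f.
have FG : F *m (c^-1 *: F^T) = 1%:M.
  by rewrite -scalemxAr frame_mx_mul_tr fc scale_scalar_mx mulVf.
have FTfull : row_full F^T.
  apply/row_fullP; exists (c^-1 *: F).
  by rewrite -scalemxAl frame_mx_mul_tr fc scale_scalar_mx mulVf.
pose P := N *: rowsub (fullrankfun FTfull) F^T.
have Pu : P \in unitmx.
  by rewrite unitmxZ ?unitfE // fullrowsub_unit.
pose H := map_mx Num.floor (P *m F).
have PF : P *m F = map_mx intr H.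
  apply/matrixP=> i j; rewrite [RHS]mxE [X in _ = (X)%:~R]mxE floorK //.
  rewrite /P -scalemxAl mul_rowsub_mx 3!mxE.
  rewrite (_ : \sum_l _ = dot (f (fullrankfun FTfull i)) (f j)).
    exact: Nint.
  by apply: eq_bigr => l _; rewrite !mxE.
have le_kn : (k <= n)%N := mulmx1_min FG.
have [L Lu [S Su [d _ HE]]] := int_Smith_normal_form H.
pose E : 'M[int]_(k, n) := rowsub (widen_ord le_kn) 1%:M.
(* [E] keeps the first [k] of [n] coordinates; its transpose is a section *)
have EET : E *m E^T = 1%:M.
  rewrite mul_rowsub_mx mul1mx; apply/matrixP=> i j; rewrite !mxE.
  by rewrite eq_sym.
pose D : 'M[int]_k := diag_mx (\row_i d`_i).
have DE : \matrix_(i, j) (d`_i *+ (i == j :> nat)) = D *m E.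
  apply/matrixP=> i j; rewrite mul_diag_mx !mxE.
  by rewrite -mulr_natr.
pose A := invmx P *m map_mx intr (L *m D).
have FE : F = A *m map_mx intr (E *m S).
  rewrite -mulmxA -map_mxM !mulmxA -(mulmxA L) -DE -HE -PF mulKmx //.
exists A; split.
  have: A *m (map_mx intr (E *m S) *m (c^-1 *: F^T)) = 1%:M.
    by rewrite mulmxA -FE.
  by case/mulmx1_unit.
rewrite ZspanE; apply/seteqP; split=> _ [z _ <-] /=.
  exists (invmx S *m E^T *m z) => //.
  rewrite -/F FE -(mulmxA A) -map_mxM !mulmxA -(mulmxA E) mulmxV // mulmx1 EET.
  by rewrite mul1mx.
by exists (E *m S *m z) => //; rewrite -/F FE -(mulmxA A) -map_mxM.
Qed.

End LatticeBasis.

(** * Minimal norm and local maximality of the density *)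

Section MinimalNorm.
Context {R : realType} {k : nat}.
Implicit Types (L : set 'cV[R]_k) (x : 'cV[R]_k).

Lemma enorm_ge0 x : 0 <= enorm x.
Proof. exact: sqrtr_ge0. Qed.

Lemma min_norm_le L x : L x -> x != 0 -> min_norm L <= enorm x.
Proof.
move=> Lx x0; apply: ge_inf; last by exists x => //; split=> //; exact/eqP.
by exists 0 => _ [y _ <-]; exact: enorm_ge0.
Qed.

Lemma le_min_norm L x (m : R) : L x -> x != 0 ->
  (forall y, L y -> y != 0 -> m <= enorm y) -> m <= min_norm L.
Proof.
move=> Lx x0 mL; apply: lb_le_inf.
  by exists (enorm x); exists x => //; split=> //; exact/eqP.
by move=> _ [y [Ly y0] <-]; apply: mL => //; exact/eqP.
Qed.

Lemma cvg_coord_dot T (F : set_system T) (FF : Filter F) (g : T -> 'cV[R]_k) x :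
  (forall i, g t i 0 @[t --> F] --> x i 0) ->
  dot (g t) (g t) @[t --> F] --> dot x x.
Proof.
move=> gx; apply: cvg_big => [|i _]; first exact: add_continuous.
by apply: cvgM; exact: gx.
Qed.

Lemma min_distance_is_lattice L : zmod_closed (mem L) ->
  (forall x, L x -> x != 0 -> 1 <= dot x x) -> is_lattice L.
Proof.
move=> [L0 LB] L1; split=> // x Lx; split; first exact/mem_set.
exists [set y | dot (y - x) (y - x) < 1].
  apply: (@cvgr_lt R _ (nbhs x) _ (fun y => dot (y - x) (y - x)) (dot 0 0)).
    apply: cvg_coord_dot => i; rewrite mxE -(subrr (x i 0)).
    under eq_cvg do rewrite mxE [(- x) i 0]mxE.
    by apply: cvgB; [exact: coord_continuous | exact: cvg_cst].
  by rewrite -[0](scale0r 0) dotZl mul0r ltr01.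
apply/seteqP; split=> [y [/= yx Ly]|_ ->]; last first.
  by split=> //=; rewrite subrr -[0](scale0r 0) dotZl mul0r ltr01.
apply/eqP; rewrite -subr_eq0; apply/negPn/negP => yx0.
have := L1 (y - x); rewrite leNgt yx => h; suff : false by [].
by apply: h => //; apply/set_mem/LB; exact/mem_set.
Qed.

End MinimalNorm.

Lemma unit_ball_volume_ge0 (R : realType) d : 0 <= unit_ball_volume d :> R.
Proof.
(* the recursion has step two *)
suff: 0 <= unit_ball_volume d :> R /\ 0 <= unit_ball_volume d.+1 :> R by case.
elim: d => [|d [IH0 IH1]]; first by rewrite /= ler01 ler0n.
by split=> //=; rewrite mulr_ge0 // divr_ge0 ?ler0n // mulr_ge0 ?ler0n ?pi_ge0.
Qed.

Section Extreme.
Context {R : realType} {n k : nat}.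
Implicit Types (f : 'I_n -> 'cV[R]_k).

Lemma Zspan_gen f i : Zspan f (f i).
Proof.
exists (fun j => (j == i)%:Z); rewrite (bigD1 i) //= eqxx mulr1z.
by rewrite big1 ?addr0 // => j /negbTE ->; rewrite mulr0z.
Qed.

(** For [B] near the basis [A], the map [T = B A^-1] carries the frame vectors
to the vectors [B *m u i] of the lattice of [B]. The smallest of their squared
norms, [t j0 B], bounds the square of the minimal norm from above, and its
[k]-th power bounds [\det T ^+ 2] from below by [det_ge_of_values]. *)
Lemma extreme_Zspan f : (0 < n)%N -> maximal_equiangular f ->
  (exists A, lattice_basis A (Zspan f)) -> min_norm (Zspan f) = 1 ->
  extreme (Zspan f).
Proof.
move=> n0 fM [A [Au AE]] min1; have [_ f1 _] := fM.
exists A; first by split.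
have /choice[z zE] : forall i, exists z : 'cV[int]_k, f i = A *m map_mx intr z.
  move=> i; have := Zspan_gen f i; rewrite -AE => -[z _ <-].
  by exists z.
pose u i := map_mx intr (z i) : 'cV[R]_k.
have u0 i : u i != 0.
  apply/eqP => ui0; have := f1 i; rewrite zE -/(u i) ui0 mulmx0 => /esym/eqP.
  by rewrite -[0](scale0r 0) dotZl mul0r oner_eq0.
pose t i (B : 'M[R]_k) := dot (B *m u i) (B *m u i).
have t_cvg i : t i B @[B --> A] --> t i A.
  apply: (@cvg_coord_dot _ _ _ (nbhs A) _ (fun B => B *m u i)) => l.
  rewrite mxE; under eq_cvg do rewrite mxE.
  apply: cvg_big => [|j _]; first exact: add_continuous.
  by apply: cvgM; [exact: coord_continuous | exact: cvg_cst].
have tA i : t i A = 1 by rewrite /t -zE f1.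
(* the bound on the excesses in [det_ge_of_values], an open condition on [B] *)
pose N : R := n%:R + k.+2%:R^-1.
have near_t : \forall B \near A, forall j, 0 < N * t j B - \sum_i t i B.
  apply: (@filter_forall _ _ (fun j B => 0 < N * t j B - \sum_i t i B)
    (nbhs A) (nbhs_filter A)) => j.
  apply: (@cvgr_gt R _ (nbhs A) (nbhs_filter A)
    (fun B => N * t j B - \sum_i t i B) (N * 1 - \sum_(i < n) 1)).
    apply: cvgB.
      by apply: cvgM; [exact: cvg_cst | rewrite -(tA j); exact: t_cvg].
    apply: cvg_big => [|i _]; first exact: add_continuous.
    by rewrite -(tA i); exact: t_cvg.
  rewrite mulr1 sumr_const card_ord subr_gt0 ltrDl invr_gt0 ltr0n //.
apply: filterS near_t => B tB Bu.
pose T := B *m invmx A; pose Q := T^T *m T.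
have tE i : t i B = \tr (Q *m (f i *m (f i)^T)).
  rewrite tr_mul_outer -dot_mulmx /t zE /T mulmxA -(mulmxA B) mulVmx //.
  by rewrite mulmx1.
have [j0 _ tmin] : exists2 j0, true & forall j, t j0 B <= t j B.
  case: (arg_minP (fun j => t j B) (i0 := Ordinal n0) (P := xpredT) isT).
  by move=> j0 _ h; exists j0 => // j; apply: h.
have Bu0 i : B *m u i != 0.
  apply: contra (u0 i) => /eqP Bui.
  by rewrite -(mulKmx Bu (u i)) Bui mulmx0.
have LBu i : lattice_of B (B *m u i) by exists (z i).
have m0 : 0 < t j0 B by rewrite lt_def dot_ge0 dot_eq0 Bu0.
set mu := min_norm (lattice_of B).
have mu0 : 0 <= mu.
  by apply: (le_min_norm (LBu j0) (Bu0 j0)) => y _ _; exact: enorm_ge0.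
have mu_le : mu ^+ 2 <= t j0 B.
  by rewrite -[t j0 B]enorm_sq lerXn2r ?nnegrE ?enorm_ge0 // min_norm_le.
have mu_det : mu ^+ k <= `|\det B| / `|\det A|.
  have -> : `|\det B| / `|\det A| = `|\det T|.
    by rewrite det_mulmx det_inv normrM normfV.
  rewrite -ler_sqr ?nnegrE ?exprn_ge0 ?normr_ge0 // exprAC.
  have -> : `|\det T| ^+ 2 = \det Q.
    by rewrite [\det Q]det_mulmx det_tr -expr2 real_normK ?num_real.
  apply: le_trans (_ : t j0 B ^+ k <= _).
    by rewrite lerXn2r ?nnegrE ?sqr_ge0 // ltW.
  apply: (det_ge_of_values fM _ m0) => [|j|]; first by rewrite trmx_mul trmxK.
    by rewrite -tE; exact: tmin.
  have := tB j0; rewrite subr_gt0 mulrC => /ltW.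
  by under eq_bigr do rewrite tE.
have dA : 0 < `|\det A| by rewrite normr_gt0 -unitfE -unitmxE.
have dB : 0 < `|\det B| by rewrite normr_gt0 -unitfE -unitmxE.
rewrite /packing_density AE min1 !expr_div_n expr1n -/mu -!mulrA.
apply: ler_wpM2l; first exact: unit_ball_volume_ge0.
rewrite mul1r mulrCA; apply: ler_wpM2l; first by rewrite invr_ge0 exprn_ge0.
by rewrite ler_pdivrMr // mulrC.
Qed.

End Extreme.

(** * The minimal vectors for 276 vectors in dimension 23 *)

Lemma even_pow4_ge (c : int) : 4 * (2 * c) ^+ 2 <= (2 * c) ^+ 4.
Proof.
have : 0 <= c ^+ 2 * (c ^+ 2 - 1).
  case: (ltrgt0P c) => c0; last by rewrite c0.
    by apply: mulr_ge0; nia.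
  by apply: mulr_ge0; nia.
by have -> : (2 * c) ^+ 4 = 16 * (c ^+ 2 * (c ^+ 2 - 1)) + 4 * (2 * c) ^+ 2;
  [ring | nia].
Qed.

Lemma odd_sq_ge1 (c : int) : 1 <= (2 * c + 1) ^+ 2.
Proof. by case: (lerP 0 c) => c0; nia. Qed.

Lemma odd_sq_lt25 (c : int) : (2 * c + 1) ^+ 2 < 25 ->
  ((2 * c + 1) ^+ 2 - 1) * ((2 * c + 1) ^+ 2 - 9) = 0.
Proof.
move=> h; have : -2 <= c <= 1 by apply/andP; split; nia.
move=> /andP[c1 c2].
have [->|[->|[->|->]]] // : c = -2 \/ c = -1 \/ c = 0 \/ c = 1 by lia.
Qed.

Section MinimalVectors.
Context {R : realType}.
Implicit Types (f : 'I_276 -> 'cV[R]_23) (x : 'cV[R]_23).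

Lemma gram_odd f : maximal_equiangular f ->
  forall i j, exists b : int, 5 * dot (f i) (f j) = (2 * b + 1)%:~R.
Proof.
move=> [_ f1 fc] i j; have [<-|ij] := eqVneq i j.
  by exists 2; rewrite f1 mulr1.
have : (5 * dot (f i) (f j)) ^+ 2 == 1.
  by rewrite exprMn (fc _ _ ij); apply/eqP; field.
rewrite sqrf_eq1 => /orP[] /eqP ->; first by exists 0.
by exists (-1).
Qed.

(** All entries of five times the Gram matrix are odd, so modulo 2 each
[5 <f_i, x>] is the sum of the coefficients of [x]. *)
Lemma Zspan_dot_parity f x : maximal_equiangular f -> Zspan f x ->
  exists (e : bool) (c : 'I_276 -> int),
    forall i, 5 * dot (f i) x = (2 * c i + e%:Z)%:~R.
Proof.
move=> fM [a ->].
have /choice[b bE] : forall ij, exists b : int,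
    5 * dot (f ij.1) (f ij.2) = (2 * b + 1)%:~R.
  by move=> [i j]; exact: gram_odd.
pose s := \sum_j a j.
have sE : s = 2 * (s %/ 2)%Z + (s %% 2)%Z by rewrite mulrC -divz_eq.
have [e eE] : exists e : bool, (s %% 2)%Z = e%:Z.
  have : (0 <= s %% 2 < 2)%Z by rewrite modz_ge0 // ltz_pmod.
  case: (s %% 2)%Z => [[|[|m]]|m] //= _; by [exists false | exists true].
exists e, (fun i => \sum_j a j * b (i, j) + (s %/ 2)%Z) => i.
rewrite dotC dot_suml mulr_sumr mulrDr -addrA -eE -sE mulr_sumr -big_split /=.
rewrite raddf_sum /=; apply: eq_bigr => j _.
rewrite -scaler_int dotZl dotC mulrCA (bE (i, j)) -intrM; congr _%:~R.
ring.
Qed.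

Lemma Zspan_sqnorm_int f x : maximal_equiangular f -> Zspan f x ->
  exists q : int, 5 * dot x x = q%:~R.
Proof.
move=> fM xL; have [e [c cE]] := Zspan_dot_parity fM xL.
have [a xE] := xL; exists (\sum_i a i * (2 * c i + e%:Z)).
rewrite {1}xE dot_suml mulr_sumr raddf_sum /=; apply: eq_bigr => i _.
by rewrite -scaler_int dotZl mulrCA intrM -cE.
Qed.

(** The second moment alone settles the case of odd [y i]. Even [y i] may vanish,
and the fourth moment then shows that the others are too large for a short [x]. *)
Lemma Zspan_min_sqnorm f x : maximal_equiangular f -> Zspan f x -> x != 0 ->
  1 <= dot x x /\ (dot x x = 1 -> exists i, x = f i \/ x = - f i).
Proof.
move=> fM xL x0; have [_ f1 _] := fM.
have [e [c cE]] := Zspan_dot_parity fM xL.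
have [q qE] := Zspan_sqnorm_int fM xL.
have := moment2 x fM; have := moment4 x fM.
set N := dot x x in qE *.
have N0 : 0 < N by rewrite lt_def dot_ge0 dot_eq0 x0.
pose y i : R := (2 * c i + e%:Z)%:~R.
have dotE i : dot (f i) x = y i / 5 by rewrite /y -cE mulrC mulKf ?pnatr_eq0.
rewrite (eq_bigr (fun i => y i ^+ 4 / 625)); last first.
  by move=> i _; rewrite dotE expr_div_n -natrX.
rewrite -mulr_suml => m4.
rewrite (eq_bigr (fun i => y i ^+ 2 / 25)); last first.
  by move=> i _; rewrite dotE expr_div_n -natrX.
rewrite -mulr_suml => m2.
have {}m4 : \sum_i y i ^+ 4 = 900 * N ^+ 2 by lra.
have {}m2 : \sum_i y i ^+ 2 = 300 * N by lra.
case: e @y cE dotE m4 m2 => y cE dotE m4 m2; last first.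
  have : 4 * (300 * N) <= 900 * N ^+ 2.
    rewrite -m4 -m2 mulr_sumr; apply: ler_sum => i _.
    rewrite /y addr0 -!rmorphXn -[4]/(4%:~R) -intrM ler_int.
    exact: even_pow4_ge.
  by move=> h; split; nra.
have N1 : 1 <= N.
  have : 276 <= 300 * N.
    rewrite -m2 -[276]/(276%:R) -{1}(card_ord 276) -sumr_const.
    by apply: ler_sum => i _; rewrite -rmorphXn ler1z odd_sq_ge1.
  move=> hN; have : (4 < q) by rewrite -(ltr_int R) -qE; lra.
  by rewrite -lez1D -(ler_int R) -qE; lra.
split=> // NE; rewrite NE in m2 m4.
have [i yi] : exists i, 25 <= y i ^+ 2.
  apply: contrapT => no.
  (* otherwise all [y i] are [1], [3] or their opposites *)
  have : \sum_i (y i ^+ 2 - 1) * (y i ^+ 2 - 9) = 0.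
    apply: big1 => i _; have : y i ^+ 2 < 25.
      by rewrite ltNge; apply/negP => yi; apply: no; exists i.
    rewrite /y -[25]/(25%:~R) -rmorphXn ltr_int => /odd_sq_lt25 yi.
    have := congr1 (fun m : int => m%:~R : R) yi.
    by rewrite rmorphM !rmorphB !rmorphXn.
  rewrite (eq_bigr (fun i => y i ^+ 4 - 10 * y i ^+ 2 + 9)); last first.
    by move=> i _; ring.
  rewrite big_split /= sumrB -mulr_sumr m2 m4 sumr_const card_ord.
  rewrite -mulr_natr. lra.
exists i; have := cauchy_unit (f1 i) NE.
have : 1 <= dot (f i) x ^+ 2 by rewrite dotE expr_div_n; lra.
move=> ge1 le1; have /eqP : dot (f i) x ^+ 2 = 1 by apply/le_anti/andP.
rewrite sqrf_eq1 => /orP[] /eqP fx; first by left; exact/esym/dot_eq1.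
right; rewrite -[x]opprK; congr (- _); apply/esym/dot_eq1 => //.
  by rewrite dotNl dotNr opprK.
by rewrite dotNr fx opprK.
Qed.

End MinimalVectors.

(** * Perfection and eutaxy *)

Section PerfectEutactic.
Context {R : realType} {n k : nat}.
Implicit Types (f : 'I_n -> 'cV[R]_k).

Definition antipodal_fset f : {fset 'cV[R]_k} :=
  [fset (-1) ^+ (p.2 : bool) *: f p.1 | p in {: 'I_n * bool}]%fset.

Lemma antipodal_fsetP f x :
  reflect (exists i, x = f i \/ x = - f i) (x \in antipodal_fset f).
Proof.
apply: (iffP idP) => [/imfsetP[[i b] _ ->]|[i fx]].
  by exists i; case: b; rewrite ?expr0 ?expr1 ?scale1r ?scaleN1r; [right|left].
apply/imfsetP; case: fx => ->.
  by exists (i, false) => //=; rewrite expr0 scale1r.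
by exists (i, true) => //=; rewrite expr1 scaleN1r.
Qed.

(** Distinct lines make an angle with squared cosine [1/(k+2) < 1]. *)
Lemma antipodal_inj f : maximal_equiangular f ->
  injective (fun p : 'I_n * bool => (-1) ^+ (p.2 : bool) *: f p.1).
Proof.
move=> [_ f1 fc] [i b] [j d] /= E.
have ij : i = j.
  apply/eqP/negPn/negP => ij; have := fc _ _ ij.
  have := congr1 (fun x => dot x x) E.
  have := congr1 (fun x => dot x (f j)) E.
  rewrite !(dotZl, dotZr) !f1 => fij _.
  have -> : dot (f i) (f j) ^+ 2 = 1.
    by rewrite -[_ ^+ 2]mul1r -(sqrr_sign _ b) -exprMn fij mulr1 !sqrr_sign.
  move/eqP; rewrite eq_sym invr_eq1 -subr_eq0 -[1]/(1%:R) -natrB //.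
  by rewrite pnatr_eq0.
subst j; congr (_, _); have := congr1 (fun x => dot x (f i)) E.
by rewrite !dotZl f1 !mulr1 => /signr_inj.
Qed.

Lemma sum_antipodal f (G : 'cV[R]_k -> R) : maximal_equiangular f ->
    (forall x, G (- x) = G x) ->
  \sum_(x <- antipodal_fset f) G x = 2 * \sum_i G (f i).
Proof.
move=> fM GN; rewrite big_imfset /=; last first.
  by move=> p q _ _; exact: antipodal_inj.
rewrite big_enum /=.
rewrite -(pair_bigA _ (fun i (b : bool) => G ((-1) ^+ b *: f i))) /=.
rewrite mulr_sumr; apply: eq_bigr => i _.
by rewrite big_bool /= expr1 expr0 scaleN1r scale1r GN mulr2n mulrDl mul1r.
Qed.

Lemma antipodal_spherical f : maximal_equiangular f -> (0 < k)%N ->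
  spherical_collection (antipodal_fset f).
Proof.
move=> fM k0; have [nE f1 _] := fM.
split=> [|x /antipodal_fsetP[i []->]]; last 2 first.
- by rewrite /enorm f1 sqrtr1.
- by rewrite /enorm dotNl dotNr opprK f1 sqrtr1.
rewrite card_imfset /=; last exact: antipodal_inj.
rewrite -cardE card_prod card_bool card_ord mulnC nE -mul_bin_diag bin1.
by rewrite leq_pmull.
Qed.

Lemma antipodal_perfect f : maximal_equiangular f -> (0 < k)%N ->
  perfect (antipodal_fset f).
Proof.
move=> fM k0; split=> [|Q]; first exact: antipodal_spherical.
split=> [QX|/(outer_span fM)[a ->]].
  have sym_sub : (<<[seq x *m x^T | x <- antipodal_fset f]>> <=
      lker (linfun ((@trmx R k k) \- idfun)))%VS.
    apply/span_subvP => _ /mapP[x _ ->].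
    by rewrite memv_ker lfunE /= outer_sym subrr.
  have := subvP sym_sub _ QX.
  by rewrite memv_ker lfunE /= subr_eq0 => /eqP.
apply: memv_suml => i _; apply/memvZ/memv_span/mapP.
by exists (f i) => //; apply/antipodal_fsetP; exists i; left.
Qed.

Lemma antipodal_eutactic f : maximal_equiangular f -> (0 < k)%N ->
  eutactic (antipodal_fset f).
Proof.
move=> fM k0; split; first exact: antipodal_spherical.
exists (fun=> k.+1%:R^-1) => [x _|y]; first by rewrite invr_gt0 ltr0n.
rewrite -mulr_sumr (sum_antipodal (G := fun x => dot y x ^+ 2)) //; last first.
  by move=> x; rewrite dotNr sqrrN.
under eq_bigr do rewrite dotC.
rewrite moment2 // enorm_sq; set K : R := k.+1%:R.
have K0 : K != 0 by rewrite pnatr_eq0.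
by field.
Qed.

End PerfectEutactic.

Theorem theorem5 (R : realType) (c : R) (f : 'I_276 -> 'cV[R]_23)
    (hf : unit_ETF c f) :
  [/\ perfect_lattice (Zspan f),
      eutactic_lattice (Zspan f) &
      extreme (Zspan f)].
Proof.
have fM : maximal_equiangular f by apply: unit_ETF_maximal hf.
have [_ f1 _] := fM.
have fn0 i : f i != 0 by rewrite -dot_eq0 f1 oner_eq0.
have i0 : 'I_276 by exact: ord0.
have enorm_f i : enorm (f i) = 1 by rewrite /enorm f1 sqrtr1.
have min1 : min_norm (Zspan f) = 1.
  apply/le_anti/andP; split.
    by rewrite -(enorm_f i0); apply: min_norm_le; first exact: Zspan_gen.
  apply: (le_min_norm (Zspan_gen f i0) (fn0 i0)) => y yL y0.
  by rewrite -sqrtr1 ler_wsqrtr //; case: (Zspan_min_sqnorm fM yL y0).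
have Zclosed : zmod_closed (mem (Zspan f)).
  split=> [|x y /set_mem[a ->] /set_mem[b ->]]; apply/mem_set.
    by exists (fun=> 0); rewrite big1.
  exists (fun i => a i - b i); rewrite -sumrB.
  by apply: eq_bigr => i _; rewrite mulrzBr.
have fL : is_lattice (Zspan f).
  apply: min_distance_is_lattice => // x xL x0.
  by case: (Zspan_min_sqnorm fM xL x0).
have XE : [set` antipodal_fset f] = unit_min_vectors (Zspan f).
  rewrite /unit_min_vectors min1 invr1; apply/seteqP; split=> x /=.
    move/antipodal_fsetP => [i fx]; exists x; last by rewrite scale1r.
    have xL : Zspan f x.
      case: fx => ->; first exact: Zspan_gen.
      by apply/set_mem/(GRing.zmod_closedN Zclosed)/mem_set/Zspan_gen.
    split=> //; rewrite min1.
    by case: fx => ->; rewrite /enorm ?dotNl ?dotNr ?opprK f1 sqrtr1.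
  move=> [y [yL y1] <-]; rewrite scale1r; apply/antipodal_fsetP.
  have yy : dot y y = 1 by rewrite -enorm_sq y1 min1 expr1n.
  have y0 : y != 0 by rewrite -dot_eq0 yy oner_eq0.
  by have [_ ] := Zspan_min_sqnorm fM yL y0; exact.
split.
- by split=> //; exists (antipodal_fset f) => //; exact: antipodal_perfect.
- by split=> //; exists (antipodal_fset f) => //; exact: antipodal_eutactic.
apply: extreme_Zspan => //.
apply: (Zspan_has_basis (N := 5) _ _ _ (outer_sum fM)) => [|i j|].
- by rewrite pnatr_eq0.
- by have [b ->] := gram_odd fM i j; exact: intr_int.
- by rewrite mulf_neq0 ?invr_neq0 ?pnatr_eq0.
Qed.
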